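(* Let $\beta>1$ and let $\psi_1,\psi_2:\mathbb{N}\to\mathbb{R}^+$ be positive functions. Assume $\underline{v}_1=\overline{v}_1=0$. If $\underline{v}_2>0$, then $\mathcal{U}(\psi_2)\subseteq\mathcal{L}(\psi_1)$.
   Context: For $\beta>1$, the $\beta$-transformation is $T_\beta(x)=\beta x-\lfloor\beta x\rfloor$ for $x\in[0,1)$, extended by $T_\beta(1)=\beta-\lfloor\beta\rfloor$; $T_\beta^n$ is its $n$-th iterate ($T_\beta^0 x=x$). For positive functions $\psi_1,\psi_2:\mathbb{N}\to\mathbb{R}^+$ define $$\mathcal{L}(\psi_1)=\{x\in[0,1]: T_\beta^n x<\psi_1(n)\text{ for infinitely many } n\in\mathbb{N}\},$$ $$\mathcal{U}(\psi_2)=\{x\in[0,1]: \text{for all sufficiently large integers } N \text{ there is an integer } n\in[0,N] \text{ with } T_\beta^n x<\psi_2(N)\}.$$ For $i=1,2$ put $$\underline{v}_i=\liminf_{n\to\infty}\frac{-\log_\beta\psi_i(n)}{n},\qquad \overline{v}_i=\limsup_{n\to\infty}\frac{-\log_\beta\psi_i(n)}{n},$$ which may equal $+\infty$. *)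

(* Defs.v *)
From HB Require Import structures.
From mathcomp Require Import all_boot all_order all_algebra.
From mathcomp Require Import all_classical all_reals all_analysis.
Set Implicit Arguments.
Unset Strict Implicit.
Unset Printing Implicit Defensive.
Import Order.TTheory GRing.Theory Num.Theory.
Import numFieldNormedType.Exports.
Local Open Scope classical_set_scope.
Local Open Scope ring_scope.

(* The single formula covers both x in [0, 1[ and x = 1, where it gives
   beta - floor beta; only points of [0, 1] are ever iterated. *)
Definition Tbeta (R : realType) (beta x : R) : R :=
  beta * x - (Num.floor (beta * x))%:~R.

Definition Lset (R : realType) (beta : R) (psi : nat -> R) : set R :=
  [set x | 0 <= x <= 1 /\
           infinite_set [set n : nat | iter n (Tbeta beta) x < psi n]].

Definition Uset (R : realType) (beta : R) (psi : nat -> R) : set R :=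
  [set x | 0 <= x <= 1 /\
           \forall N \near \oo,
             exists n : nat, (n <= N)%N /\ iter n (Tbeta beta) x < psi N].

Definition logb (R : realType) (beta x : R) : R := ln x / ln beta.

(* The junk value 0 of the term n = 0 (division by zero) does not affect the
   lower and upper limits. *)
Definition vlow (R : realType) (beta : R) (psi : nat -> R) : \bar R :=
  limn_einf (fun n : nat => (- logb beta (psi n) / n%:R)%:E).

Definition vup (R : realType) (beta : R) (psi : nat -> R) : \bar R :=
  limn_esup (fun n : nat => (- logb beta (psi n) / n%:R)%:E).

(* Main.v *)
Require Import Defs.
From HB Require Import structures.
From mathcomp Require Import all_boot all_order all_algebra.
From mathcomp Require Import all_classical all_reals all_analysis.
Set Implicit Arguments.
Unset Strict Implicit.
Unset Printing Implicit Defensive.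
Import Order.TTheory GRing.Theory Num.Theory.
Import numFieldNormedType.Exports.
Local Open Scope classical_set_scope.
Local Open Scope ring_scope.

(** Fix a real [c] with [0 < c < vlow psi2] and put [q = beta `^ (- c)], so that
    [0 < q < 1].  Eventually [psi2 N < q ^+ N], because [c] is below the lower
    limit of [psi2], and eventually [q ^+ n < psi1 n], because the upper limit
    of [psi1] is [0 < c] ([lt_vlow_near], [vup_lt_near]).

    Let [x] be uniformly approximated at rate [psi2].  If the orbit of [x] meets
    [0], it stays there, and [0 < psi1 n] for every [n].  Otherwise every orbit
    point is positive.  For each large [N] some [n <= N] satisfies
    [T^n x < psi2 N < q ^+ N <= q ^+ n].  This [n] cannot remain bounded as [N]
    grows, because finitely many positive orbit points have a positive minimum
    while [q ^+ N] tends to [0] ([uniform_geometric_approx]).  Hence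
    [T^n x < q ^+ n < psi1 n] for arbitrarily large [n].

    The orbits meeting [0] form a separate case because there one single [n] can
    serve for all [N], so that [n] need not grow. *)

Lemma infinite_set_nat (A : set nat) :
  (forall M, exists2 n, (M <= n)%N & A n) -> infinite_set A.
Proof.
move=> unbdA /finite_seqP[B AB].
have [n] := unbdA (\max_(i <- B) i).+1.
rewrite AB => /[swap] /= nB; rewrite ltnNge => /negP; apply.
exact: (@leq_bigmax_seq _ _ xpredT id).
Qed.

Lemma limn_esup_lt_near (R : realType) (u : nat -> \bar R) (a : \bar R) :
  (limn_esup u < a)%E -> \forall n \near \oo, (u n < a)%E.
Proof.
move=> /ereal_inf_lt[_ [V Voo <-]] supV.
apply: filterS Voo => n Vn; apply: le_lt_trans supV.
by apply: ereal_sup_ubound; exists n.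
Qed.

Lemma lt_limn_einf_near (R : realType) (u : nat -> \bar R) (a : \bar R) :
  (a < limn_einf u)%E -> \forall n \near \oo, (a < u n)%E.
Proof.
rewrite /limn_einf lteNr => /limn_esup_lt_near.
by apply: filterS => n; rewrite lteN2.
Qed.

Section DecayRates.
Variables (R : realType) (beta : R) (psi : nat -> R).
Hypotheses (beta_gt1 : 1 < beta) (psi_gt0 : forall n, 0 < psi n).

Let ln_beta_gt0 : 0 < ln beta. Proof. exact: ln_gt0. Qed.

Let beta_gt0 : 0 < beta. Proof. exact: lt_trans ltr01 beta_gt1. Qed.

Let ln_geometric (c : R) n : ln ((beta `^ (- c)) ^+ n) = - (c * n%:R * ln beta).
Proof.
rewrite lnXn ?powR_gt0// ln_powR mulNr mulNrn.
by rewrite mulr_natr mulrnAl.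
Qed.

Let geometric_pos (c : R) n : (beta `^ (- c)) ^+ n \in Num.pos.
Proof. by rewrite posrE exprn_gt0// powR_gt0. Qed.

(** Multiplying [c < - logb beta (psi n) / n] by [- n * ln beta] turns it into a
    comparison of logarithms.  The index [n = 0], where the quotient is the
    junk value [0], has to be discarded. *)
Lemma lt_vlow_near (c : R) : (c%:E < vlow beta psi)%E ->
  \forall n \near \oo, psi n < (beta `^ (- c)) ^+ n.
Proof.
move=> /lt_limn_einf_near; move: (nbhs_infty_gt 0); apply: filterS2 => n n_gt0.
rewrite lte_fin ltr_pdivlMr ?ltr0n// /logb -mulNr ltr_pdivlMr// => cn.
by rewrite -ltr_ln ?geometric_pos ?posrE// ln_geometric ltrNr.
Qed.

Lemma vup_lt_near (c : R) : (vup beta psi < c%:E)%E ->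
  \forall n \near \oo, (beta `^ (- c)) ^+ n < psi n.
Proof.
move=> /limn_esup_lt_near; move: (nbhs_infty_gt 0); apply: filterS2 => n n_gt0.
rewrite lte_fin ltr_pdivrMr ?ltr0n// /logb -mulNr ltr_pdivrMr// => cn.
by rewrite -ltr_ln ?geometric_pos ?posrE// ln_geometric ltrNl.
Qed.

End DecayRates.

(** The terms [u n] with [n < M] have a positive minimum.  Once [q ^+ N] is
    below it, the index provided for [N] is at least [M]; and [n <= N] gives
    [q ^+ N <= q ^+ n]. *)
Lemma uniform_geometric_approx (R : realType) (u : nat -> R) (q : R) :
    (forall n, 0 < u n) -> 0 <= q < 1 ->
    (\forall N \near \oo, exists2 n, (n <= N)%N & u n < q ^+ N) ->
  forall M, exists2 n, (M <= n)%N & u n < q ^+ n.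
Proof.
move=> u_gt0 /andP[q_ge0 q_lt1] uq M.
have qN_small : \forall N \near \oo, forall n, (n < M)%N -> q ^+ N < u n.
  elim: M => [|M IH]; first exact: nearW.
  have q0 : q ^+ N @[N --> \oo] --> 0 by apply: cvg_expr; rewrite ger0_norm.
  have qM : \forall N \near \oo, q ^+ N < u M.
    by exact: cvgr_lt q0 _ (u_gt0 M).
  apply: filterS (filterI IH qM) => N [{}IH {}qM] n.
  by rewrite ltnS leq_eqVlt => /predU1P[->|/IH].
have [N [small [n nN un]]] := filter_ex (filterI qN_small uq).
exists n; last by apply: lt_le_trans un _; rewrite ler_wiXn2l// ltW.
by rewrite leqNgt; apply/negP => /small /(lt_trans un); rewrite ltxx.
Qed.

Section Orbits.
Variables (R : realType) (beta : R).

Lemma Tbeta_ge0 (x : R) : 0 <= Tbeta beta x.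
Proof. by rewrite subr_ge0 floor_le. Qed.

Lemma iter_Tbeta0 n : iter n (Tbeta beta) 0 = 0.
Proof. by elim: n => //= n ->; rewrite /Tbeta mulr0 floor0 subrr. Qed.

(** Every orbit point is nonnegative, so a point that is not positive is [0],
    and [0] is fixed. *)
Lemma orbit_pos_or_eventually0 (x : R) : 0 <= x ->
  (forall n, 0 < iter n (Tbeta beta) x) \/
  \forall n \near \oo, iter n (Tbeta beta) x = 0.
Proof.
move=> x_ge0.
have orbit_ge0 n : 0 <= iter n (Tbeta beta) x.
  by case: n => //= n; exact: Tbeta_ge0.
have [[k xk0]|noz] := pselect (exists k, iter k (Tbeta beta) x = 0).
  right; exists k => // n /= kn.
  by rewrite -(subnK kn) iterD xk0 iter_Tbeta0.
left => n; rewrite lt_def orbit_ge0 andbT.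
by apply/eqP => xn0; apply: noz; exists n.
Qed.

End Orbits.

Theorem theorem4 (R : realType) (beta : R) (psi1 psi2 : nat -> R)
    (beta_gt1 : 1 < beta)
    (psi1_gt0 : forall n : nat, 0 < psi1 n)
    (psi2_gt0 : forall n : nat, 0 < psi2 n)
    (vlow1 : vlow beta psi1 = 0%E)
    (vup1 : vup beta psi1 = 0%E)
    (vlow2 : (0 < vlow beta psi2)%E) :
  Uset beta psi2 `<=` Lset beta psi1.
Proof.
move=> x [x01 unif]; split=> //; apply: infinite_set_nat => M.
have [orbit_gt0|orbit0] := @orbit_pos_or_eventually0 R beta x (andP x01).1;
  last first.
  have [n [Mn xn0]] := filter_ex (filterI (nbhs_infty_ge M) orbit0).
  by exists n => //=; rewrite xn0.
have [c c_gt0 cv2] : exists2 c : R, 0 < c & (c%:E < vlow beta psi2)%E.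
  case: (vlow beta psi2) vlow2 => [r||]//.
  - by rewrite lte_fin => r_gt0; exists (r / 2); rewrite ?lte_fin ?divr_gt0//
      ltr_pdivrMr// mulr_natr ltr_pwDr.
  - by exists 1 => //; exact: ltry.
have psi2_lt := lt_vlow_near beta_gt1 psi2_gt0 cv2.
have psi1_gt : \forall n \near \oo, (beta `^ (- c)) ^+ n < psi1 n.
  by apply: vup_lt_near => //; rewrite vup1 lte_fin.
have q01 : 0 <= beta `^ (- c) < 1.
  have beta_gt0 := lt_trans ltr01 beta_gt1.
  rewrite powR_ge0 -ltr_ln ?posrE ?powR_gt0//.
  by rewrite ln_powR ln1 mulNr oppr_lt0 mulr_gt0 ?ln_gt0.
have [K _ psi1_gtK] := psi1_gt.
have [|n Mn xn] := uniform_geometric_approx orbit_gt0 q01 _ (maxn M K).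
  move: unif psi2_lt; apply: filterS2 => N [n [nN xn]] psiN.
  by exists n => //; exact: lt_trans psiN.
move: Mn; rewrite geq_max => /andP[Mn Kn].
by exists n => //=; apply: lt_trans xn (psi1_gtK _ Kn).
Qed.
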